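(* $\langle\forall^\infty\forall\rangle\not\le_{\sf m}\langle\forall\forall^\infty\rangle$.
   Context: Quantifiers range over $\omega$. $\exists^\infty n\,\varphi(n)$ means $\forall m\exists n\ge m\,\varphi(n)$ and $\forall^\infty n\,\varphi(n)$ means $\exists m\forall n\ge m\,\varphi(n)$. A quantifier-pattern is a finite string $\bar{\mathsf Q}=\mathsf Q_0\dots\mathsf Q_\ell$ over $\{\exists,\forall,\exists^\infty,\forall^\infty\}$. A $\bar{\mathsf Q}$-formula is $\varphi(\bar x)\equiv\mathsf Q_0n_0\dots\mathsf Q_\ell n_\ell\,\theta(n_0,\dots,n_\ell,\bar x)$ with $\theta$ bounded. The instance $\bar x$ is a tuple of natural numbers and/or total computable functions (computable elements of $\omega^\omega$). Spaces such as $\omega\times\omega^\omega$, $(\omega^\omega)^\omega$, $\omega^{\omega\times\omega}$ are identified with $\omega^\omega$ by computable pairing. Witnesses: for $\alpha\in\omega^\omega$, $\alpha\Vdash\varphi(\bar x)$ (''$\alpha$ is a witness for $\varphi(\bar x)$'') is defined by: $\alpha\Vdash\theta(\bar x)$ iff $\alpha=\bar x$ and $\theta(\bar x)$, for bounded $\theta$; $\langle t,\alpha\rangle\Vdash\exists n\varphi(n,\bar x)$ iff $\alpha\Vdash\varphi(t,\bar x)$; $\alpha\Vdash\forall n\varphi(n,\bar x)$ iff $\alpha(n)\Vdash\varphi(n,\bar x)$ for all $n$; $\langle t,\alpha\rangle\Vdash\forall^\infty n\varphi(n,\bar x)$ iff $\alpha(n)\Vdash\varphi(n,\bar x)$ for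 all $n\ge t$; $\alpha\Vdash\exists^\infty n\varphi(n,\bar x)$ iff for all $n$, writing $\alpha(n)=\langle k,\beta\rangle$, $k\ge n$ and $\beta\Vdash\varphi(k,\bar x)$. $\varphi\le_{\sf m}\psi$ if there are computable functions $\eta,r_-,r_+$ (type-two computable functionals, possibly partial but defined wherever required) such that for every instance $\bar x$: $\varphi(\bar x)$ is true iff $\psi(\eta(\bar x))$ is true; $\alpha\Vdash\varphi(\bar x)$ implies $r_-(\alpha,\bar x)\Vdash\psi(\eta(\bar x))$; $\alpha\Vdash\psi(\eta(\bar x))$ implies $r_+(\alpha,\bar x)\Vdash\varphi(\bar x)$ ($\alpha\in\omega^\omega$ arbitrary). $\langle\bar{\mathsf Q}\rangle$ denotes a fixed $\bar{\mathsf Q}$-formula to which every $\bar{\mathsf Q}$-formula is $\le_{\sf m}$-reducible; concretely $\langle\bar{\mathsf Q}\rangle(x)\equiv\mathsf Q_0n_0\dots\mathsf Q_\ell n_\ell.\ x(n_0,\dots,n_\ell)=0$ (the choice does not matter up to $\equiv_{\sf m}$). *)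

(* Defs.v *)
From Stdlib Require Import Arith List.
From Stdlib Require Cantor.
Import ListNotations.

Definition baire := nat -> nat.

(** * Pairings on [nat] and on Baire space *)

Notation "⟨ a , b ⟩" := (Cantor.to_nat (a, b)) (at level 0, format "⟨ a ,  b ⟩").

(* [bcons t a] is the pair <t, a> in omega * omega^omega; [bhead], [btail] are
   its projections. *)
Definition bcons (t : nat) (a : baire) : baire :=
  fun i => match i with 0 => t | S j => a j end.
Definition bhead (a : baire) : nat := a 0.
Definition btail (a : baire) : baire := fun i => a (S i).

(* The n-th component of [a] seen as an element of (omega^omega)^omega. *)
Definition brow (a : baire) (n : nat) : baire := fun k => a ⟨n, k⟩.

(* The pair (a, b) in omega^omega * omega^omega. *)
Definition bjoin (a b : baire) : baire :=
  fun n => if Nat.even n then a (Nat.div2 n) else b (Nat.div2 n).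

Fixpoint tuple_code (ns : list nat) : nat :=
  match ns with
  | [] => 0
  | [n] => n
  | n :: ns' => ⟨n, tuple_code ns'⟩
  end.

(** * Computability relative to an oracle *)

(* Kleene's partial recursive functions with an oracle, presented as unary
   functions: several arguments are packed with the Cantor pairing. *)
Inductive code : Set :=
| Zero | Succ | Fst | Snd | Oracle
| Pair (f g : code)
| Comp (f g : code)
| Prec (f g : code)
| Mu (f : code).

(* [eval o c n v]: with oracle [o], program [c] halts on [n] with value [v]. *)
Fixpoint eval (o : baire) (c : code) {struct c} : nat -> nat -> Prop :=
  match c with
  | Zero => fun _ v => v = 0
  | Succ => fun n v => v = S n
  | Fst => fun n v => v = fst (Cantor.of_nat n)
  | Snd => fun n v => v = snd (Cantor.of_nat n)
  | Oracle => fun n v => v = o n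
  | Pair f g => fun n v =>
      exists a b, eval o f n a /\ eval o g n b /\ v = ⟨a, b⟩
  | Comp f g => fun n v => exists a, eval o g n a /\ eval o f a v
  | Prec f g => fun n =>
      let a := fst (Cantor.of_nat n) in
      (fix iter (k : nat) : nat -> Prop :=
         match k with
         | 0 => eval o f a
         | S i => fun v => exists w, iter i w /\ eval o g ⟨a, ⟨i, w⟩⟩ v
         end) (snd (Cantor.of_nat n))
  | Mu f => fun n v =>
      eval o f ⟨n, v⟩ 0 /\ forall i, i < v -> exists w, eval o f ⟨n, i⟩ (S w)
  end.

Definition computable (x : baire) : Prop :=
  exists c, forall n, eval (fun _ => 0) c n (x n).

(* A code denotes a partial type-two functional: [maps c x y] says that it is
   defined at [x] with value [y]. *)
Definition maps (c : code) (x y : baire) : Prop :=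
  forall n, eval x c n (y n).

(** * Formulas, truth and witnesses *)

Inductive quantifier : Set :=
| Ex       (* exists *)
| All      (* for all *)
| ExInf    (* for infinitely many *)
| AllInf.  (* for all but finitely many *)

Definition pattern := list quantifier.

(* A prefix, and a matrix theta(n_0,...,n_l,x). Tuples of parameters are coded
   by the single x. Truth, witnesses and reducibility make sense for any matrix,
   so boundedness is not imposed here; the only matrix used is the one of
   [canonical]. *)
Record formula := Formula {
  prefix : pattern;
  matrix : list nat -> baire -> Prop
}.

(* In the next two definitions [ns] lists the values of the outer quantified
   variables, outermost first. *)
Fixpoint holds_from (Q : pattern) (theta : list nat -> baire -> Prop)
    (ns : list nat) (x : baire) : Prop :=
  match Q with
  | [] => theta ns x
  | Ex :: Q' => exists n, holds_from Q' theta (ns ++ [n]) x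
  | All :: Q' => forall n, holds_from Q' theta (ns ++ [n]) x
  | ExInf :: Q' => forall m, exists n, m <= n /\ holds_from Q' theta (ns ++ [n]) x
  | AllInf :: Q' => exists m, forall n, m <= n -> holds_from Q' theta (ns ++ [n]) x
  end.

(* At the matrix the instance is the whole tuple (n_0,...,n_l,x), coded as
   <n_0,<n_1,...<n_l,x>...>>; equality in omega^omega is pointwise. *)
Fixpoint witness_from (Q : pattern) (theta : list nat -> baire -> Prop)
    (ns : list nat) (x : baire) (a : baire) : Prop :=
  match Q with
  | [] => (forall i, a i = fold_right bcons x ns i) /\ theta ns x
  | Ex :: Q' => witness_from Q' theta (ns ++ [bhead a]) x (btail a)
  | All :: Q' => forall n, witness_from Q' theta (ns ++ [n]) x (brow a n)
  | ExInf :: Q' => forall n,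
      let k := bhead (brow a n) in
      n <= k /\ witness_from Q' theta (ns ++ [k]) x (btail (brow a n))
  | AllInf :: Q' => forall n, bhead a <= n ->
      witness_from Q' theta (ns ++ [n]) x (brow (btail a) n)
  end.

Definition holds (phi : formula) (x : baire) : Prop :=
  holds_from (prefix phi) (matrix phi) [] x.

Definition witness (phi : formula) (x a : baire) : Prop :=
  witness_from (prefix phi) (matrix phi) [] x a.

(** * Many-one reducibility *)

(* The functionals are total only where they have to be: [eta] on the computable
   x, [rminus] and [rplus] on the witnesses. *)
Definition m_reducible (phi psi : formula) : Prop :=
  exists eta rminus rplus : code,
    forall x, computable x ->
      exists y, maps eta x y /\
        (holds phi x <-> holds psi y) /\
        (forall a, witness phi x a ->
           exists b, maps rminus (bjoin a x) b /\ witness psi y b) /\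
        (forall a, witness psi y a ->
           exists b, maps rplus (bjoin a x) b /\ witness phi x b).

(* Q_0 n_0 ... Q_l n_l. x(n_0,...,n_l) = 0 *)
Definition canonical (Q : pattern) : formula :=
  Formula Q (fun ns x => x (tuple_code ns) = 0).

(* Main.v *)
(** Start from the instance [x = 0] and its witness with bound [0].  The reduction
    sends it to a witness [b] of [y = eta 0], and [rplus] reads from [b], using only
    rows [n < N], a bound [T] for [x].  Now present [x] with the weaker bound [T + 1]:
    by continuity [rminus] fixes bounds for the rows [n < N] of [y] after reading a
    finite part of [x].  Placing a [1] in row [T] of [x] far beyond all parts read so
    far keeps the bound [T + 1] valid, hence those rows of the new [y'] still vanish
    beyond the fixed bounds, and below them [y'] agrees with [y].  So the part of [b]
    that was read extends to a witness for [y'], and from it [rplus] still computes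
    the bound [T], which is now wrong. *)

Require Import Defs.
From Stdlib Require Import List.
From Stdlib Require Import Arith Lia.
From Stdlib Require Cantor.
Import ListNotations.

(** * Finite agreement and uniform bounds *)

Definition agree (N : nat) (a b : baire) : Prop := forall i, i < N -> a i = b i.

Lemma agree_le M N a b : M <= N -> agree N a b -> agree M a b.
Proof. intros HMN H i Hi; apply H; lia. Qed.

Lemma agree_bjoin N a a' x x' :
  agree N a a' -> agree N x x' -> agree N (bjoin a x) (bjoin a' x').
Proof.
  intros Ha Hx i Hi; unfold bjoin.
  assert (Nat.div2 i < N) by (pose proof (Nat.div2_decr i i (Nat.le_succ_diag_r i)); lia).
  destruct (Nat.even i); auto.
Qed.

Lemma agree_bcons N n a a' : agree N a a' -> agree N (bcons n a) (bcons n a').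
Proof. intros Ha [|i] Hi; [reflexivity | apply Ha; lia]. Qed.

Lemma bounded_below (f : nat -> nat) N : exists L, forall n, n < N -> f n < L.
Proof.
  induction N as [|N [L HL]].
  - exists 0; lia.
  - exists (S (Nat.max L (f N))); intros n Hn.
    destruct (Nat.eq_dec n N) as [->|Hne]; [lia|].
    specialize (HL n); lia.
Qed.

Lemma uniform_bound (P : nat -> nat -> Prop) N :
  (forall n M M', M <= M' -> P n M -> P n M') ->
  (forall n, n < N -> exists M, P n M) ->
  exists M, forall n, n < N -> P n M.
Proof.
  intros Hmono; induction N as [|N IH]; intros H.
  - exists 0; lia.
  - destruct IH as [M HM]; [intros; apply H; lia|].
    destruct (H N) as [M' HM']; [lia|].
    exists (Nat.max M M'); intros n Hn.
    destruct (Nat.eq_dec n N) as [->|Hne].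
    + apply (Hmono N M'); [lia | assumption].
    + apply (Hmono n M); [lia | apply HM; lia].
Qed.

Lemma to_nat_ge_l n k : n <= ⟨n, k⟩.
Proof. pose proof (Cantor.to_nat_non_decreasing n k); lia. Qed.

Lemma to_nat_ge_r n k : k <= ⟨n, k⟩.
Proof. pose proof (Cantor.to_nat_non_decreasing n k); lia. Qed.

Lemma of_nat_ind (P : nat -> Prop) : (forall n k, P ⟨n, k⟩) -> forall i, P i.
Proof.
  intros H i; rewrite <- (Cantor.cancel_to_of i).
  destruct (Cantor.of_nat i); apply H.
Qed.

(** * Determinism and continuity of oracle computations *)

Lemma eval_deterministic o c : forall n v w, eval o c n v -> eval o c n w -> v = w.
Proof.
  induction c as [| | | | |f IHf g IHg|f IHf g IHg|f IHf g IHg|f IHf]; cbn [eval];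
    try congruence.
  - intros n v w (a & b & Ha & Hb & ->) (a' & b' & Ha' & Hb' & ->).
    now rewrite (IHf _ _ _ Ha Ha'), (IHg _ _ _ Hb Hb').
  - intros n v w (a & Ha & Hv) (a' & Ha' & Hw).
    rewrite (IHg _ _ _ Ha Ha') in Hv; eauto.
  - intros n; cbv zeta; generalize (snd (Cantor.of_nat n)) as k.
    induction k as [|k IHk]; intros v w.
    + apply IHf.
    + intros (a & Ha & Hv) (a' & Ha' & Hw).
      rewrite (IHk _ _ Ha Ha') in Hv; eauto.
  - intros n v w [Hv Hv'] [Hw Hw'].
    destruct (lt_eq_lt_dec v w) as [[Hlt|Heq]|Hlt]; [|assumption|].
    + destruct (Hw' _ Hlt) as [u Hu]; discriminate (IHf _ _ _ Hv Hu).
    + destruct (Hv' _ Hlt) as [u Hu]; discriminate (IHf _ _ _ Hw Hu).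
Qed.

Definition use_bound (o : baire) (P : baire -> Prop) (M : nat) : Prop :=
  forall o', agree M o o' -> P o'.

Lemma use_bound_le o P M M' : M <= M' -> use_bound o P M -> use_bound o P M'.
Proof. intros HM H o' Ho; apply H; eapply agree_le; eauto. Qed.

Lemma use_bound_and o (P Q R : baire -> Prop) :
  (forall o', P o' -> Q o' -> R o') ->
  (exists M, use_bound o P M) -> (exists M, use_bound o Q M) ->
  exists M, use_bound o R M.
Proof.
  intros H [M HM] [M' HM']; exists (Nat.max M M'); intros o' Ho.
  apply H; [apply HM | apply HM']; eapply agree_le; try exact Ho; lia.
Qed.

(** A halting computation queries its oracle only finitely often. *)
Lemma eval_continuous o c :
  forall n v, eval o c n v -> exists M, use_bound o (fun o' => eval o' c n v) M.
Proof.
  induction c as [| | | | |f IHf g IHg|f IHf g IHg|f IHf g IHg|f IHf]; cbn [eval];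
    try (intros n v Hv; exists 0; intros o' _; exact Hv).
  - intros n v ->; exists (S n); intros o' Ho; apply Ho; lia.
  - intros n v (a & b & Ha & Hb & ->).
    refine (use_bound_and _ _ _ _ _ (IHf _ _ Ha) (IHg _ _ Hb)); eauto 6.
  - intros n v (a & Ha & Hv).
    refine (use_bound_and _ _ _ _ _ (IHg _ _ Ha) (IHf _ _ Hv)); eauto.
  - intros n; cbv zeta; generalize (snd (Cantor.of_nat n)) as k.
    induction k as [|k IHk]; intros v.
    + apply IHf.
    + intros (a & Ha & Hv).
      refine (use_bound_and _ _ _ _ _ (IHk _ Ha) (IHg _ _ Hv)); eauto.
  - intros n v [Hv Hlt].
    refine (use_bound_and _ _ (fun o' => forall i, i < v -> exists w, eval o' f ⟨n, i⟩ (S w))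
              _ _ (IHf _ _ Hv) _); [eauto|].
    (* The finitely many rejected candidates [i < v] share one use bound. *)
    destruct (uniform_bound
                (fun i => use_bound o (fun o' => exists w, eval o' f ⟨n, i⟩ (S w))) v)
      as [M HM].
    + intros i M M'; apply use_bound_le.
    + intros i Hi; destruct (Hlt i Hi) as [w Hw].
      destruct (IHf _ _ Hw) as [M HM]; exists M; intros o' Ho; eauto.
    + exists M; intros o' Ho i Hi; exact (HM i Hi o' Ho).
Qed.

(** By continuity the first [N] values of [y] are also computed from [x']; determinism identifies
    them with those of [y']. *)
Lemma maps_continuous c x y N :
  maps c x y ->
  exists M, forall x' y', agree M x x' -> maps c x' y' -> agree N y y'.
Proof.
  intros H.
  destruct (uniform_bound (fun i => use_bound x (fun x' => eval x' c i (y i))) N)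
    as [M HM].
  - intros i M M'; apply use_bound_le.
  - intros i _; exact (eval_continuous _ _ _ _ (H i)).
  - exists M; intros x' y' Hx Hy i Hi.
    exact (eval_deterministic _ _ _ _ _ (HM i Hi x' Hx) (Hy i)).
Qed.

(** * Computable instances *)

Definition zero : baire := fun _ => 0.
Definition spike (m : nat) : baire := fun n => if Nat.eqb n m then 1 else 0.

Lemma computable_zero : computable zero.
Proof. exists Zero; reflexivity. Qed.

Lemma agree_zero_spike m : agree m zero (spike m).
Proof.
  intros i Hi; unfold spike, zero.
  destruct (Nat.eqb_spec i m); [lia | reflexivity].
Qed.

Lemma computable_prec (f : code) (a : nat) (h : baire) :
  eval zero f 0 a -> computable h ->
  computable (fun n => match n with 0 => a | S i => h i end).
Proof.
  intros Hf [g Hg].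
  (* Case distinction as a recursion that ignores the previous value; the parameter is a dummy [0],
     and [Pair Fst Snd] is the identity. *)
  exists (Comp (Prec f (Comp g (Comp Fst Snd))) (Pair Zero (Pair Fst Snd))).
  intros n; cbn [eval]; exists ⟨0, n⟩; split.
  - exists 0, n; repeat split.
    do 2 eexists; repeat split.
    rewrite <- surjective_pairing. symmetry; apply Cantor.cancel_to_of.
  - rewrite Cantor.cancel_of_to; cbn [fst snd].
    induction n as [|n IH]; [exact Hf|].
    exists (match n with 0 => a | S i => h i end); split; [exact IH|].
    exists n; split; [|apply Hg].
    eexists; split; [reflexivity|].
    rewrite Cantor.cancel_of_to; cbn [snd].
    now rewrite Cantor.cancel_of_to.
Qed.

Lemma computable_ext (x y : baire) :
  (forall n, x n = y n) -> computable x -> computable y.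
Proof. intros H [c Hc]; exists c; intros n; rewrite <- H; apply Hc. Qed.

Lemma computable_spike m : computable (spike m).
Proof.
  induction m as [|m IH].
  - apply (computable_ext (fun n => match n with 0 => 1 | S i => zero i end)).
    + now intros [|n].
    + apply (computable_prec (Comp Succ Zero)); [|exact computable_zero].
      exists 0; split; reflexivity.
  - apply (computable_ext (fun n => match n with 0 => 0 | S i => spike m i end)).
    + now intros [|n].
    + apply (computable_prec Zero); [reflexivity | exact IH].
Qed.

(** * Building and modifying witnesses *)

(* The [AllInf; All]-witness with bound [t]; it also fills the rows below [t], which
   are unconstrained. *)
Definition bound_witness (t : nat) (x : baire) : baire :=
  bcons t (fun i => let (n, r) := Cantor.of_nat i in
                    let (k, l) := Cantor.of_nat r in bcons n (bcons k x) l).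

Lemma bound_witness_correct t x :
  (forall n k, t <= n -> x ⟨n, k⟩ = 0) ->
  witness (canonical [AllInf; All]) x (bound_witness t x).
Proof.
  intros H n Hn k; split; [|exact (H n k Hn)].
  intros i; unfold bound_witness, btail, brow, bcons at 1.
  now rewrite !Cantor.cancel_of_to.
Qed.

Lemma agree_bound_witness N t x x' :
  agree N x x' -> agree N (bound_witness t x) (bound_witness t x').
Proof.
  intros Hx; apply agree_bcons; intros i.
  induction i as [n r] using of_nat_ind; rewrite Cantor.cancel_of_to.
  induction r as [k l] using of_nat_ind; rewrite Cantor.cancel_of_to.
  intros Hi.
  pose proof (to_nat_ge_r n ⟨k, l⟩); pose proof (to_nat_ge_r k l).
  apply (agree_bcons N); [apply (agree_bcons N), Hx | lia].
Qed.

(* On the rows [n < N], [graft N b y' b'] has the bounds of [b] but speaks about [y'];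
   on the others it is [b']. *)
Definition graft (N : nat) (b y' b' : baire) : baire :=
  fun i =>
    let (n, j) := Cantor.of_nat i in
    if n <? N then
      match j with
      | 0 => b i
      | S m => let (k, l) := Cantor.of_nat m in
               if b ⟨n, 0⟩ <=? k then bcons n (bcons k y') l else b i
      end
    else b' i.

Lemma graft_correct N b y' b' :
  witness (canonical [All; AllInf]) y' b' ->
  (forall n k, n < N -> b ⟨n, 0⟩ <= k -> y' ⟨n, k⟩ = 0) ->
  witness (canonical [All; AllInf]) y' (graft N b y' b').
Proof.
  intros Hb' Hy n k; unfold bhead, btail, brow.
  unfold graft at 1; rewrite Cantor.cancel_of_to.
  destruct (Nat.ltb_spec n N) as [Hn|Hn]; intros Hk; split.
  - intros i; unfold graft; rewrite !Cantor.cancel_of_to.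
    destruct (Nat.ltb_spec n N); [|lia].
    destruct (Nat.leb_spec (b ⟨n, 0⟩) k); [reflexivity | lia].
  - exact (Hy n k Hn Hk).
  - intros i; unfold graft; rewrite Cantor.cancel_of_to.
    destruct (Nat.ltb_spec n N); [lia|].
    exact (proj1 (Hb' n k Hk) i).
  - exact (proj2 (Hb' n k Hk)).
Qed.

(** Positions below [N] lie in rows [n < N]. There, past its bound, the witness [b] must spell out
    [n], [k] and [y], and [y] agrees with [y'] as far as it is visible; all other entries are copied
    from [b]. *)
Lemma agree_graft N b y y' b' :
  witness (canonical [All; AllInf]) y b -> agree N y y' ->
  agree N b (graft N b y' b').
Proof.
  intros Hb Hy i; unfold graft.
  induction i as [n j] using of_nat_ind; rewrite Cantor.cancel_of_to; intros Hi.
  pose proof (to_nat_ge_l n j); pose proof (to_nat_ge_r n j).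
  destruct (Nat.ltb_spec n N); [|lia].
  destruct j as [|m]; [reflexivity|].
  induction m as [k l] using of_nat_ind; rewrite Cantor.cancel_of_to.
  destruct (Nat.leb_spec (b ⟨n, 0⟩) k) as [Hk|]; [|reflexivity].
  transitivity (bcons n (bcons k y) l).
  - exact (proj1 (Hb n k Hk) l).
  - pose proof (to_nat_ge_r k l).
    apply (agree_bcons N); [apply (agree_bcons N), Hy | lia].
Qed.

Theorem theorem4p13 :
  ~ m_reducible (canonical [AllInf; All]) (canonical [All; AllInf]).
Proof.
  intros (eta & rminus & rplus & Hred).
  destruct (Hred zero computable_zero) as (y & Hy & _ & Hminus & Hplus).
  assert (H0 : forall t, witness (canonical [AllInf; All]) zero (bound_witness t zero))
    by (intros t; apply bound_witness_correct; reflexivity).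
  destruct (Hminus _ (H0 0)) as (b & _ & Hb).
  destruct (Hplus _ Hb) as (c & Hc & _).
  set (T := c 0).
  (* Precision 1 suffices: only the bound [c 0] is needed. *)
  destruct (maps_continuous _ _ _ 1 Hc) as [N HN].
  destruct (Hminus _ (H0 (S T))) as (d & Hd & _).
  (* [D] covers the positions where [d] stores its bounds for the rows [n < N]; [L] will cover the
     cells of these rows below those bounds. *)
  destruct (bounded_below (fun n => ⟨n, 0⟩) N) as [D HD].
  destruct (maps_continuous _ _ _ D Hd) as [M1 HM1].
  destruct (uniform_bound (fun n L => forall k, k < d ⟨n, 0⟩ -> ⟨n, k⟩ < L) N)
    as [L HL].
  { intros n L L' HLL H k Hk; specialize (H k Hk); lia. }
  { intros n _; apply bounded_below. }
  destruct (maps_continuous _ _ _ (Nat.max N L) Hy) as [M2 HM2].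
  (* Beyond what is read by [rplus] ([N]), [rminus] ([M1]) and [eta] ([M2]). *)
  set (K := Nat.max N (Nat.max M1 M2)).
  set (x' := spike ⟨T, K⟩).
  assert (Hx : agree K zero x').
  { apply (agree_le K ⟨T, K⟩); [apply to_nat_ge_r | apply agree_zero_spike]. }
  assert (HxT : forall n k, S T <= n -> x' ⟨n, k⟩ = 0).
  { intros n k Hn; unfold x', spike.
    destruct (Nat.eqb_spec ⟨n, k⟩ ⟨T, K⟩) as [E|]; [|reflexivity].
    apply Cantor.to_nat_inj in E; injection E; lia. }
  destruct (Hred x' (computable_spike _)) as (y' & Hy' & _ & Hminus' & Hplus').
  assert (Hyy : agree (Nat.max N L) y y').
  { apply (HM2 x'); [|exact Hy']; apply (agree_le M2 K); [lia | exact Hx]. }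
  destruct (Hminus' _ (bound_witness_correct (S T) x' HxT)) as (d' & Hd' & Hwd').
  assert (Hdd : agree D d d').
  { apply (HM1 _ d') in Hd'; [exact Hd'|].
    apply (agree_le M1 K); [lia|].
    apply agree_bjoin; [apply agree_bound_witness|]; exact Hx. }
  assert (Hvanish : forall n k, n < N -> b ⟨n, 0⟩ <= k -> y' ⟨n, k⟩ = 0).
  { intros n k Hn Hk.
    (* Below the bound of [d], [y'] copies [y], which vanishes there because [b] is a witness; from
       that bound on, [d'] has the same bound and certifies the zero. *)
    destruct (Nat.lt_ge_cases k (d ⟨n, 0⟩)) as [Hkd|Hkd].
    - rewrite <- Hyy by (specialize (HL n Hn k Hkd); lia).
      exact (proj2 (Hb n k Hk)).
    - rewrite (Hdd _ (HD n Hn)) in Hkd.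
      exact (proj2 (Hwd' n k Hkd)). }
  destruct (Hplus' _ (graft_correct N b y' d' Hwd' Hvanish)) as (c' & Hc' & Hwc').
  assert (HT : T = c' 0).
  { apply (HN _ c') in Hc'; [apply Hc'; lia|].
    apply agree_bjoin.
    - apply (agree_graft N b y); [exact Hb|].
      apply (agree_le N (Nat.max N L)); [lia | exact Hyy].
    - apply (agree_le N K); [lia | exact Hx]. }
  (* The bound [T] claims that row [T] of [x'] vanishes, yet the spike sits in column [K] of that
     row. *)
  assert (Hle : bhead c' <= T) by (unfold bhead; lia).
  pose proof (proj2 (Hwc' T Hle K)) as Hone.
  change (x' ⟨T, K⟩ = 0) in Hone.
  unfold x', spike in Hone; rewrite Nat.eqb_refl in Hone; discriminate.
Qed.
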